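(* If $q>q_0$ is an integer with $\gcd(q,\rho_C)=1$, then $$\chi\big(\mathcal{A}^{(B,\mathbf b)},q\big)=\chi^{\mathrm{quasi}}\big(\mathcal{A}^{(B,\mathbf b)},q\big).$$ Moreover, $\chi\big(\mathcal{A}^{(B,\mathbf b)},t\big)=f_1\big(\mathcal{A}^{(B,\mathbf b)},t\big)$.
   Context: Let $A$ be an $m\times n$ integer matrix with rows $\boldsymbol\alpha_1^T,\dots,\boldsymbol\alpha_m^T$, $B$ an $l\times n$ integer matrix ($l=0$ is allowed: no equations), $\mathbf a=(a_1,\dots,a_m)^T\in\mathbb{Z}^m$, $\mathbf b\in\mathbb{Z}^l$, and $[m]=\{1,\dots,m\}$. Let $V(B,\mathbf b)=\{\mathbf x\in\mathbb{R}^n: B\mathbf x=\mathbf b\}$ and $H_i^{(B,\mathbf b)}=\{\mathbf x\in V(B,\mathbf b):\boldsymbol\alpha_i^T\mathbf x=a_i\}$; the truncated arrangement is $\mathcal{A}^{(B,\mathbf b)}=\{H_1^{(B,\mathbf b)},\dots,H_m^{(B,\mathbf b)}\}$. Its characteristic polynomial is $$\chi\big(\mathcal{A}^{(B,\mathbf b)},t\big)=\sum_{J\subseteq[m],\ \bigcap_{j\in J}H_j^{(B,\mathbf b)}\ne\emptyset}(-1)^{\#J}t^{\dim(\bigcap_{j\in J}H_j^{(B,\mathbf b)})},$$ where for $J=\emptyset$ the intersection is $V(B,\mathbf b)$; it is the zero polynomial if $V(B,\mathbf b)=\emptyset$. For $J\subseteq[m]$, let $A_J$ and $\mathbf a_J$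 consist of the rows of $A$ and entries of $\mathbf a$ indexed by $J$; $C_J=\begin{bmatrix}B\\ A_J\end{bmatrix}$, $\mathbf c_J=\begin{bmatrix}\mathbf b\\ \mathbf a_J\end{bmatrix}$, $\bar C_J=[C_J\ \mathbf c_J]$; $r(J)=\operatorname{rank}C_J$, $\bar r(J)=\operatorname{rank}\bar C_J$ (ranks over $\mathbb{Q}$). The invariant factors of an integer matrix are the nonzero diagonal entries (taken positive, each dividing the next) of its Smith normal form; let $d_{J,1}\mid\cdots\mid d_{J,r(J)}$ be those of $C_J$ and $\bar d_{J,1}\mid\cdots\mid\bar d_{J,\bar r(J)}$ those of $\bar C_J$. Put $\rho_C=\operatorname{lcm}\{d_{J,r(J)}: J\subseteq[m],\ \bar r(J)=r(J)\}$ and $q_0=\max\{\bar d_{J,\bar r(J)}: J\subseteq[m],\ \bar r(J)=r(J)+1\}$, with $q_0=0$ if no such $J$ exists; $d_{J,0}=1$ and the lcm of the empty set is $1$. For positive integers $q$ let $d_J(q)=\prod_{j=1}^{r(J)}\gcd(d_{J,j},q)$, and let $\tilde d_J(q)=d_J(q)$ if $\gcd(q,d_{J,j})=\gcd(q,\bar d_{J,j})$ for all $j=1,\dots,\bar r(J)$, and $\tilde d_J(q)=0$ otherwise, where $d_{J,\bar r(J)}:=0$ if $\bar r(J)=r(J)+1$ (and $\gcd(q,0)=q$). The characteristic quasi-polynomial is $$\chi^{\mathrm{quasi}}\big(\mathcal{A}^{(B,\mathbf b)},q\big)=\sum_{J\subseteq[m],\ \bar r(J)=r(J)}(-1)^{\#J}\tilde{d}_J(q)\,q^{n-r(J)},$$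 a quasi-polynomial in $q$ with period $\rho_C$. Its first constituent $f_1\big(\mathcal{A}^{(B,\mathbf b)},t\big)$ is the unique polynomial with $f_1\big(\mathcal{A}^{(B,\mathbf b)},q\big)=\chi^{\mathrm{quasi}}\big(\mathcal{A}^{(B,\mathbf b)},q\big)$ for all positive integers $q\equiv 1\pmod{\rho_C}$. *)

(* Defs.v *)
From HB Require Import structures.
From mathcomp Require Import all_boot all_order all_algebra.
From mathcomp Require Import boolp classical_sets reals.

Set Implicit Arguments.
Unset Strict Implicit.
Unset Printing Implicit Defensive.

Import Order.TTheory GRing.Theory Num.Theory.

Local Open Scope classical_set_scope.
Local Open Scope ring_scope.

(* Dimension of S when S is a nonempty affine subspace x + U: the dimension of
   its (unique) direction U.  Any other S gets the junk value 0. *)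
Definition affine_dim (R : realType) n (S : set 'cV[R]_n) : nat :=
  \dim (xget 0%VS [set U : {vspace 'cV[R]_n} |
                    exists x, S = [set x + u | u in [set u | u \in U]]]).

Definition arr_flat (R : realType) m n (V : set 'cV[R]_n)
    (H : 'I_m -> set 'cV[R]_n) (J : {set 'I_m}) : set 'cV[R]_n :=
  V `&` \bigcap_(j in [set j | j \in J]) H j.

(* The family H is indexed: repeated hyperplanes count separately, as in the
   sum over subsets of [m]. *)
Definition arr_charpoly (R : realType) m n (V : set 'cV[R]_n)
    (H : 'I_m -> set 'cV[R]_n) : {poly int} :=
  \sum_(J : {set 'I_m} | `[< arr_flat V H J !=set0 >])
    (-1) ^+ #|J| *: 'X^(affine_dim (arr_flat V H J)).

Definition solution_space (R : realType) l n (B : 'M[int]_(l, n))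
    (b : 'cV[int]_l) : set 'cV[R]_n :=
  [set x | map_mx intr B *m x = map_mx intr b].

Definition hyperplane (R : realType) m n l (A : 'M[int]_(m, n))
    (a : 'cV[int]_m) (B : 'M[int]_(l, n)) (b : 'cV[int]_l) (i : 'I_m) :
    set 'cV[R]_n :=
  [set x | solution_space B b x /\
           map_mx intr (row i A) *m x = (a i ord0)%:~R%:M].

Definition charpoly (R : realType) m n l (A : 'M[int]_(m, n))
    (a : 'cV[int]_m) (B : 'M[int]_(l, n)) (b : 'cV[int]_l) : {poly int} :=
  arr_charpoly (@solution_space R l n B b) (hyperplane A a B b).

Definition smith_diag m n (M : 'M[int]_(m, n)) : seq int :=
  let: existT2 _ _ (existT2 _ _ (exist2 d _ _)) := int_Smith_normal_form M in d.

Lemma smith_diagP m n (M : 'M[int]_(m, n)) :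
  sorted dvdz (smith_diag M) /\
  exists L : 'M[int]_m, exists R : 'M[int]_n,
    [/\ L \in unitmx, R \in unitmx &
        M = L *m (\matrix_(i, j) ((smith_diag M)`_i *+ (i == j :> nat))) *m R].
Proof.
rewrite /smith_diag; case: int_Smith_normal_form => L uL [R uR [d sd eM]].
by split=> //; exists L, R.
Qed.

(* The library does not bound the length of the diagonal sequence, hence the
   truncation.  By divisibility its zeros come last, so filtering them out
   leaves the positions of the other entries unchanged. *)
Definition invariant_factors m n (M : 'M[int]_(m, n)) : seq nat :=
  [seq `|x|%N | x <- take (minn m n) (smith_diag M) & x != 0].

(* The j-th invariant factor, counted from 1; it is 1 for j = 0 and 0 for j
   greater than the rank. *)
Definition invariant_factor m n (M : 'M[int]_(m, n)) (j : nat) : nat :=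
  if j is j'.+1 then nth 0%N (invariant_factors M) j' else 1%N.

Definition qrank m n (M : 'M[int]_(m, n)) : nat :=
  \rank (map_mx intr M : 'M[rat]_(m, n)).

Section Data.
Variables (m n l : nat).
Variables (A : 'M[int]_(m, n)) (a : 'cV[int]_m).
Variables (B : 'M[int]_(l, n)) (b : 'cV[int]_l).

Definition subrows p (M : 'M[int]_(m, p)) (J : {set 'I_m}) :
    'M[int]_(#|J|, p) :=
  rowsub (fun i : 'I_#|J| => enum_val i) M.

Definition C_ (J : {set 'I_m}) : 'M[int]_(l + #|J|, n) :=
  col_mx B (subrows A J).

Definition c_ (J : {set 'I_m}) : 'cV[int]_(l + #|J|) :=
  col_mx b (subrows a J).

Definition Cbar (J : {set 'I_m}) : 'M[int]_(l + #|J|, n + 1) :=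
  row_mx (C_ J) (c_ J).

Definition rk (J : {set 'I_m}) : nat := qrank (C_ J).
Definition rkbar (J : {set 'I_m}) : nat := qrank (Cbar J).

Definition d_ (J : {set 'I_m}) (j : nat) : nat := invariant_factor (C_ J) j.
Definition dbar (J : {set 'I_m}) (j : nat) : nat :=
  invariant_factor (Cbar J) j.

Definition rhoC : nat :=
  \big[lcmn/1%N]_(J : {set 'I_m} | rkbar J == rk J) d_ J (rk J).

Definition q0 : nat :=
  (\max_(J : {set 'I_m} | rkbar J == (rk J).+1) dbar J (rkbar J))%N.

Definition dprod (J : {set 'I_m}) (q : nat) : nat :=
  (\prod_(1 <= j < (rk J).+1) gcdn (d_ J j) q)%N.

(* When rkbar J = (rk J).+1, the last test uses d_ J (rkbar J) = 0. *)
Definition dtilde (J : {set 'I_m}) (q : nat) : nat :=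
  if all (fun j => gcdn q (d_ J j) == gcdn q (dbar J j)) (iota 1 (rkbar J))
  then dprod J q else 0%N.

Definition chi_quasi (q : nat) : int :=
  \sum_(J : {set 'I_m} | rkbar J == rk J)
    (-1) ^+ #|J| * (dtilde J q)%:Z * q%:Z ^+ (n - rk J)%N.

(* The defining property of the first constituent, which is the unique
   polynomial satisfying it. *)
Definition is_first_constituent (f : {poly int}) : Prop :=
  forall q : nat, (0 < q)%N -> q = 1 %[mod rhoC] -> f.[q%:Z] = chi_quasi q.

End Data.

(* Main.v *)
Require Import Defs.
From HB Require Import structures.
From mathcomp Require Import all_boot all_order all_algebra.
From mathcomp Require Import boolp classical_sets reals.

Set Implicit Arguments.
Unset Strict Implicit.
Unset Printing Implicit Defensive.

Import Order.TTheory GRing.Theory Num.Theory.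
Local Open Scope ring_scope.

(** Over R, the flat of J is nonempty exactly when rkbar J = rk J, and then it
    has dimension n - rk J; so it suffices that dtilde J q = 1 for such J when
    q is coprime to rhoC.  The rank of an integer matrix over a field is the
    number of its invariant factors that do not vanish there.  If a prime p
    divides q, no invariant factor of C_J vanishes mod p, so C_J keeps its rank
    mod p; hence so does Cbar_J, and p divides none of its invariant factors
    either.  Thus all gcds with q are 1.  A polynomial is determined by its
    values on the infinite progression 1 + rhoC * k, as rhoC > 0. *)

(** * Rank of an integer matrix over a field, from its Smith normal form *)

Lemma mxrank_rect_diag (F : fieldType) m n r (e : nat -> F) :
    (r <= minn m n)%N -> (forall i, (i < r)%N = (e i != 0)) ->
  \rank (\matrix_(i < m, j < n) (e i *+ (i == j :> nat))) = r.
Proof.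
rewrite leq_min => /andP[le_rm le_rn] e_neq0.
(* The zero entries from index [r] on are replaced by 1, which makes [diag_mx u] invertible;
   [pid_mx r] then restores the zeros. *)
pose u : 'rV[F]_m := \row_i (if (i < r)%N then e i else 1).
have -> : \matrix_(i < m, j < n) (e i *+ (i == j :> nat))
          = diag_mx u *m pid_mx r.
  apply/matrixP=> i j; rewrite mul_diag_mx !mxE.
  have [lt_ir|] := boolP (i < r)%N; first by rewrite andbT mulr_natr.
  by rewrite e_neq0 negbK => /eqP->; rewrite andbF mulr0 mul0rn.
rewrite eqmxMfull ?rank_pid_mx // row_full_unit unitmxE det_diag unitfE.
apply/prodf_neq0 => i _; rewrite mxE.
by case: ifP => [|_]; [rewrite e_neq0 | exact: oner_neq0].
Qed.

(** As [P] passes to divisors, the entries of a divisibility chain that satisfy it form an initial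
    segment. The condition at 0 covers indices past the end, where the default value is 0. *)
Lemma ltn_count_sorted_dvdz (P : pred int) (s : seq int) (i : nat) :
    (forall x y, (x %| y)%Z -> P y -> P x) -> ~~ P 0 -> sorted dvdz s ->
  (i < count P s)%N = P s`_i.
Proof.
move=> dvdP P0; elim: s i => [|x s IHs] i /=; first by rewrite nth_nil (negPf P0).
move=> x_s; have dvd_s j : (x %| s`_j)%Z.
  have [lt_js | le_sj] := ltnP j (size s); last by rewrite nth_default ?dvdz0.
  by have /all_nthP-> := order_path_min (fun y z t => @dvdz_trans y z t) x_s.
have {}IHs := IHs _ (path_sorted x_s).
case: (boolP (P x)) => [Px | notPx]; first by case: i => [|i] /=; rewrite ?Px // ltnS IHs.
have notPs j : P s`_j = false by apply: contraNF notPx; exact: dvdP.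
have -> : count P s = 0 by apply/eqP; rewrite -leqn0 leqNgt IHs notPs.
by case: i => [|i] /=; rewrite ?(negPf notPx) ?notPs.
Qed.

Lemma intr_eq0_abs (F : fieldType) (x : int) : (x%:~R == 0 :> F) = (`|x|%N%:R == 0 :> F).
Proof. by case: x => k //=; rewrite NegzE mulrNz oppr_eq0. Qed.

(** The unimodular factors of the Smith form stay invertible over [F], so only the image of the
    diagonal matters. *)
Lemma mxrank_map_intr (F : fieldType) m n (M : 'M[int]_(m, n)) :
  \rank (map_mx intr M : 'M[F]_(m, n))
  = count (fun k => k%:R != 0 :> F) (invariant_factors M).
Proof.
rewrite /invariant_factors.
have [sd [L [U [uL uU defM]]]] := smith_diagP M.
set s := take _ _; set r := count _ _.
pose P (x : int) := x%:~R != 0 :> F.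
have defr : r = count P s.
  rewrite /r count_map count_filter; apply: eq_count => x /=.
  by rewrite /P intr_eq0_abs; case: (eqVneq x 0) => [->|_]; rewrite ?eqxx ?andbT.
have PE i : (i < r)%N = ((s`_i)%:~R != 0 :> F).
  rewrite defr (ltn_count_sorted_dvdz (P := P)) ?take_sorted //; last by rewrite /P eqxx.
  move=> x y /dvdzP[z ->]; rewrite /P rmorphM mulf_eq0 negb_or.
  by case/andP.
have le_r : (r <= minn m n)%N.
  by rewrite defr (leq_trans (count_size _ _)) // size_take_min geq_minl.
have unit_map k (N : 'M[int]_k) : N \in unitmx -> (map_mx intr N : 'M[F]_k) \in unitmx.
  by rewrite !unitmxE det_map_mx; apply: rmorph_unit.
have fullL : row_full (map_mx intr L : 'M[F]_m) by rewrite row_full_unit unit_map.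
have freeU : row_free (map_mx intr U : 'M[F]_n) by rewrite row_free_unit unit_map.
rewrite defM !map_mxM mxrankMfree // eqmxMfull //.
rewrite -[RHS](mxrank_rect_diag le_r PE); congr (\rank _).
apply/matrixP=> i j; rewrite !mxE.
(* A diagonal position has index below both [m] and [n], so the truncation of the Smith sequence
   leaves its entry unchanged. *)
have [eq_ij|] := eqVneq (i : nat) j; last by rewrite !mulr0n.
by rewrite !mulr1n nth_take // leq_min ltn_ord eq_ij ltn_ord.
Qed.

Lemma invariant_factors_gt0 m n (M : 'M[int]_(m, n)) k :
  k \in invariant_factors M -> (0 < k)%N.
Proof.
by case/mapP=> x; rewrite mem_filter => /andP[x_neq0 _] ->; rewrite absz_gt0.
Qed.

(** In characteristic zero every invariant factor stays nonzero and is counted. This lets ranks over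
    the rationals and over the reals be exchanged. *)
Lemma mxrank_map_intr_num (F : numFieldType) m n (M : 'M[int]_(m, n)) :
  \rank (map_mx intr M : 'M[F]_(m, n)) = size (invariant_factors M).
Proof.
rewrite mxrank_map_intr; apply/eqP; rewrite -all_count.
by apply/allP=> k /invariant_factors_gt0; rewrite pnatr_eq0 -lt0n.
Qed.

Lemma size_invariant_factors m n (M : 'M[int]_(m, n)) :
  size (invariant_factors M) = qrank M.
Proof. by rewrite /qrank mxrank_map_intr_num. Qed.

Lemma sorted_invariant_factors m n (M : 'M[int]_(m, n)) :
  sorted dvdn (invariant_factors M).
Proof.
rewrite sorted_map; apply: sorted_filter; first by move=> y x z; apply: dvdn_trans.
by apply: take_sorted; case: (smith_diagP M).
Qed.

Lemma qrankE (F : numFieldType) m n (M : 'M[int]_(m, n)) :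
  qrank M = \rank (map_mx intr M : 'M[F]_(m, n)).
Proof. by rewrite -size_invariant_factors mxrank_map_intr_num. Qed.

(** * Reduction modulo a prime and coprimality of invariant factors *)

Lemma mxrank_Fp_qrank p m n (M : 'M[int]_(m, n)) : prime p ->
  (\rank (map_mx intr M : 'M['F_p]_(m, n)) == qrank M)
  = all (fun k => ~~ (p %| k)%N) (invariant_factors M).
Proof.
move=> p_pr; rewrite mxrank_map_intr -size_invariant_factors -all_count.
by apply: eq_all => k; rewrite (dvdn_pcharf (pchar_Fp p_pr)).
Qed.

Lemma leq_mxrank_Fp_qrank p m n (M : 'M[int]_(m, n)) :
  (\rank (map_mx intr M : 'M['F_p]_(m, n)) <= qrank M)%N.
Proof. by rewrite mxrank_map_intr -size_invariant_factors count_size. Qed.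

Lemma leq_mxrank_row_mx (F : fieldType) m n1 n2
    (M : 'M[F]_(m, n1)) (N : 'M[F]_(m, n2)) :
  (\rank M <= \rank (row_mx M N))%N.
Proof. by rewrite -mxrank_tr -[leqRHS]mxrank_tr tr_row_mx -addsmxE mxrankS ?addsmxSl. Qed.

(** Every invariant factor divides the last one. *)
Lemma coprime_invariant_factors m n (M : 'M[int]_(m, n)) q :
    coprime q (invariant_factor M (qrank M)) ->
  {in invariant_factors M, forall k, coprime q k}.
Proof.
rewrite -size_invariant_factors => co_q k /(nthP 0%N)[i lt_is <-].
(* A member exists, so the rank is positive and the convention for [j = 0] in [invariant_factor]
   does not interfere. *)
have s_gt0 : (0 < size (invariant_factors M))%N by apply: leq_ltn_trans lt_is.
move: co_q; rewrite -(prednK s_gt0) /=; apply: coprime_dvdr.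
apply: (sorted_leq_nth (fun y x z => @dvdn_trans y x z) dvdnn) => //.
- exact: sorted_invariant_factors.
- by rewrite inE prednK.
- by rewrite -ltnS prednK.
Qed.

Lemma coprime_invariant_factors_row_mx m n1 n2
    (M : 'M[int]_(m, n1)) (N : 'M[int]_(m, n2)) q :
    (0 < q)%N -> qrank (row_mx M N) = qrank M ->
    coprime q (invariant_factor M (qrank M)) ->
  {in invariant_factors (row_mx M N), forall k, coprime q k}.
Proof.
move=> q_gt0 eq_rk /coprime_invariant_factors co_q k k_s.
rewrite coprime_has_primes ?(invariant_factors_gt0 k_s) //.
apply/hasPn=> p /[!mem_primes] /and3P[p_pr _ p_k]; apply/negP => /and3P[_ _ p_q].
have: \rank (map_mx intr M : 'M['F_p]_(m, n1)) == qrank M.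
  rewrite mxrank_Fp_qrank //; apply/allP=> j /co_q co_qj.
  by rewrite -prime_coprime // (coprime_dvdl p_q).
move=> /eqP rkM.
suff: \rank (map_mx intr (row_mx M N) : 'M['F_p]_(m, _)) == qrank (row_mx M N).
  by rewrite mxrank_Fp_qrank // => /allP/(_ k k_s); rewrite p_k.
(* Modulo [p], the rank of the extended matrix is squeezed between that of [M] and its own rational
   rank, both equal to [qrank M]. *)
by rewrite eqn_leq leq_mxrank_Fp_qrank eq_rk -rkM map_row_mx leq_mxrank_row_mx.
Qed.

Lemma invariant_factor_mem m n (M : 'M[int]_(m, n)) j :
  (0 < j <= qrank M)%N -> invariant_factor M j \in invariant_factors M.
Proof. by case: j => //= j; rewrite -size_invariant_factors => /mem_nth->. Qed.

Lemma invariant_factor_qrank_gt0 m n (M : 'M[int]_(m, n)) :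
  (0 < invariant_factor M (qrank M))%N.
Proof.
case: (posnP (qrank M)) => [-> //|rk_gt0].
by apply: (@invariant_factors_gt0 _ _ M); rewrite invariant_factor_mem ?rk_gt0 /=.
Qed.

(** * Consistency of linear systems and dimension of their solution sets *)

Lemma mxrank_row_mxP (F : fieldType) m n p (M : 'M[F]_(m, n)) (N : 'M[F]_(m, p)) :
  reflect (exists X, M *m X = N) (\rank (row_mx M N) == \rank M).
Proof.
rewrite -mxrank_tr tr_row_mx -addsmxE -(mxrank_tr M) eq_sym.
(* After transposition, equality of ranks means that the row space of [N^T] lies in that of
   [M^T]. *)
rewrite (mxrank_leqif_sup (addsmxSl _ _)) addsmx_sub submx_refl /=.
apply: (iffP submxP) => [] [X defN].
  by exists X^T; apply: trmx_inj; rewrite trmx_mul trmxK.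
by exists X^T; rewrite -defN trmx_mul.
Qed.

Lemma dim_lker_mulmx (F : fieldType) m n (M : 'M[F]_(m, n)) :
  \dim (lker (linfun (mulmx M : 'cV_n -> 'cV_m))) = (n - \rank M)%N.
Proof.
(* [row_base M] has the same kernel as [M] but full row rank, hence is surjective, and rank-nullity
   gives the dimension. *)
pose f := linfun (mulmx (row_base M) : 'cV[F]_n -> 'cV[F]_(\rank M)).
have -> : lker (linfun (mulmx M : 'cV_n -> 'cV_m)) = lker f.
  apply/vspaceP=> x; rewrite !memv_ker !lfunE /= -{1}(mulmx_base M) -mulmxA.
  have [L LK] := row_fullP (col_base_full M).
  apply/eqP/eqP=> [Mx0 | ->]; last by rewrite mulmx0.
  by rewrite -[LHS]mul1mx -LK -mulmxA Mx0 mulmx0.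
have fT : limg f = fullv.
  apply/eqP; rewrite eqEsubv subvf; apply/subvP=> y _.
  have [U UK] := row_freeP (row_base_free M).
  have -> : y = f (U *m y) by rewrite lfunE /= mulmxA UK mul1mx.
  exact: memv_img (memvf _).
have := limg_ker_dim f fullv; rewrite capfv fT !dimvf /dim /= !muln1 => dimE.
by apply: (canRL (addnK _)).
Qed.

(** An affine subspace determines its direction, so the choice made by [xget] can only be [U]. *)
Lemma affine_dim_translate (R : realType) n (x : 'cV[R]_n) (U : {vspace 'cV[R]_n}) :
  affine_dim [set x + u | u in [set u | u \in U]]%classic = \dim U.
Proof.
rewrite /affine_dim; congr (\dim _); apply: xget_unique; first by exists x.
move=> W [y eqUW].
have memP u : u \in U <-> exists2 w, w \in W & y + w = x + u.
  split=> [uU | [w wW eq_yw]].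
    have : [set x + u | u in [set u | u \in U]]%classic (x + u) by exists u.
    by rewrite eqUW => -[w /= wW eq_yw]; exists w.
  have : [set y + u | u in [set u | u \in W]]%classic (x + u) by exists w.
  by rewrite -eqUW => -[v /= vU /addrI <-].
(* [w0] is the shift from the base point [y] to the base point [x]; it lies in [W], so translating
   by it preserves [W]. *)
have [w0 w0W eq_w0] := (memP 0).1 (mem0v U).
rewrite addr0 in eq_w0.
apply/vspaceP=> v; apply/idP/idP=> [vW | /memP[w wW]].
  apply/memP; exists (w0 + v); first exact: memvD.
  by rewrite addrA eq_w0.
rewrite -eq_w0 -addrA => /addrI defw.
by have := memvB wW w0W; rewrite defw addrAC subrr add0r.
Qed.

Section SolutionSpace.
Variables (R : realType) (m n : nat) (M : 'M[int]_(m, n)) (c : 'cV[int]_m).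

Lemma solution_space_nonempty :
  `[< solution_space (R := R) M c !=set0 >]%classic = (qrank (row_mx M c) == qrank M).
Proof.
rewrite !(qrankE R) map_row_mx; apply/asboolP/mxrank_row_mxP.
  by case=> x Mx; exists x.
by case=> x Mx; exists x.
Qed.

Lemma affine_dim_solution_space :
    qrank (row_mx M c) = qrank M ->
  affine_dim (solution_space (R := R) M c) = (n - qrank M)%N.
Proof.
move=> /eqP; rewrite -solution_space_nonempty => /asboolP[x0 Mx0].
rewrite (qrankE R) -dim_lker_mulmx -(affine_dim_translate x0); congr affine_dim.
apply/seteqP; split=> [x Mx | x [u /= uK <-]].
  exists (x - x0); last by rewrite addrC subrK.
  by rewrite /= memv_ker lfunE /= mulmxBr Mx Mx0 subrr.
move: uK; rewrite memv_ker lfunE /= => /eqP Mu0.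
by rewrite /solution_space /= mulmxDr Mu0 addr0.
Qed.

End SolutionSpace.

(** Otherwise [f - g] would be a nonzero polynomial with as many distinct roots as its size, one
    more than its degree. *)
Lemma poly_eq_on_nat (D : numDomainType) (f g : {poly D}) (h : nat -> nat) :
  injective h -> (forall k, f.[(h k)%:R] = g.[(h k)%:R]) -> f = g.
Proof.
move=> h_inj eq_fg; apply/eqP; rewrite -subr_eq0; apply/idPn => fg_neq0.
pose rs : seq D := [seq (h k)%:R | k <- iota 0 (size (f - g))].
have : (size rs < size (f - g)%R)%N.
  apply: max_poly_roots => //.
    by apply/allP=> _ /mapP[k _ ->]; rewrite rootE hornerD hornerN eq_fg subrr.
  by rewrite map_inj_uniq ?iota_uniq // => j k /eqP; rewrite eqr_nat => /eqP/h_inj.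
by rewrite size_map size_iota ltnn.
Qed.

(** * Term-by-term comparison of the two sums over subsets *)

Section Arrangement.
Variables (R : realType) (m n l : nat).
Variables (A : 'M[int]_(m, n)) (a : 'cV[int]_m).
Variables (B : 'M[int]_(l, n)) (b : 'cV[int]_l).
Implicit Types (J : {set 'I_m}) (q : nat).

(** Stacking the equations of the chosen hyperplanes under [B] turns a flat into the solution set of
    a single system. *)
Lemma arr_flatE J :
  arr_flat (solution_space (R := R) B b) (hyperplane A a B b) J
  = solution_space (C_ A B J) (c_ a b J).
Proof.
have rowE (x : 'cV[R]_n) i :
    map_mx intr (row i A) *m x = (a i ord0)%:~R%:M
    <-> (map_mx intr A *m x) i ord0 = (a i ord0)%:~R.
  rewrite map_row -row_mul; split=> [/matrixP/(_ ord0 ord0) | eq_i].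
    by rewrite !mxE.
  by apply/matrixP=> j k; rewrite !ord1 !mxE mulr1n -eq_i mxE.
have mulA_J (x : 'cV[R]_n) k :
    (map_mx intr (subrows A J) *m x) k ord0 = (map_mx intr A *m x) (enum_val k) ord0.
  by rewrite !mxE; apply: eq_bigr => j _; rewrite !mxE.
rewrite /solution_space /C_ /c_; apply/seteqP; split=> x /=.
  case=> Bx HJ; rewrite !map_col_mx mul_col_mx Bx; congr col_mx.
  apply/matrixP=> k j; rewrite ord1 mulA_J !mxE.
  by have [_ /rowE] := HJ _ (enum_valP k); rewrite mxE.
rewrite !map_col_mx mul_col_mx => /eq_col_mx[Bx AJx]; split=> // i iJ.
(* [enum_rank_in iJ i] is the position of row [i] of [A] inside [subrows A J]. *)
split=> //; apply/rowE; have := mulA_J x (enum_rank_in iJ i).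
by rewrite enum_rankK_in // AJx !mxE enum_rankK_in // => <-.
Qed.

Lemma charpolyE :
  charpoly R A a B b =
  \sum_(J : {set 'I_m} | rkbar A a B b J == rk A B J)
    (-1) ^+ #|J| *: 'X^(n - rk A B J).
Proof.
rewrite /charpoly /arr_charpoly; apply: eq_big => J.
  by rewrite arr_flatE solution_space_nonempty.
by rewrite arr_flatE solution_space_nonempty => /eqP/affine_dim_solution_space->.
Qed.

Lemma rhoC_gt0 : (0 < rhoC A a B b)%N.
Proof.
rewrite /rhoC; elim/big_ind: _ => // [i j i_gt0 j_gt0 | J _].
  by rewrite lcmn_gt0 i_gt0.
exact: invariant_factor_qrank_gt0.
Qed.

Lemma dtilde_coprime J q : (0 < q)%N -> rkbar A a B b J = rk A B J ->
  coprime q (d_ A B J (rk A B J)) -> dtilde A a B b J q = 1%N.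
Proof.
move=> q_gt0 eq_rk co_q.
have coM j : (0 < j <= rk A B J)%N -> coprime q (d_ A B J j).
  by move=> /invariant_factor_mem/(coprime_invariant_factors co_q).
have coN j : (0 < j <= rk A B J)%N -> coprime q (dbar A a B b J j).
  rewrite -eq_rk => /invariant_factor_mem.
  exact: (coprime_invariant_factors_row_mx q_gt0 eq_rk co_q).
rewrite /dtilde ifT.
  rewrite /dprod big_nat_cond big1 // => j; rewrite andbT ltnS => /coM.
  by rewrite coprime_sym => /eqP.
(* With equal ranks the test stops at [rk A B J], before the default 0 of [d_] appears; both gcds
   are then 1. *)
apply/allP=> j; rewrite mem_iota add1n ltnS eq_rk => j_rk.
by rewrite (eqP (coM j j_rk)) (eqP (coN j j_rk)).
Qed.

Lemma horner_charpoly q : (0 < q)%N -> coprime q (rhoC A a B b) ->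
  (charpoly R A a B b).[q%:Z] = chi_quasi A a B b q.
Proof.
move=> q_gt0 co_q; rewrite charpolyE horner_sum; apply: eq_bigr => J rkJ.
rewrite hornerZ hornerXn dtilde_coprime ?mulr1 //; first exact/eqP.
(* The last invariant factor for [J] is one of the terms of the lcm [rhoC], hence coprime to [q]. *)
exact: coprime_dvdr (biglcmn_sup J rkJ (dvdnn _)) co_q.
Qed.

End Arrangement.

Theorem corollary2p6 (R : realType) (m n l : nat)
    (A : 'M[int]_(m, n)) (a : 'cV[int]_m)
    (B : 'M[int]_(l, n)) (b : 'cV[int]_l) :
  (forall q : nat, (q0 A a B b < q)%N -> coprime q (rhoC A a B b) ->
     (charpoly R A a B b).[q%:Z] = chi_quasi A a B b q)
  /\ unique (is_first_constituent A a B b) (charpoly R A a B b).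
Proof.
split=> [q q_gt co_q | ].
  by apply: horner_charpoly => //; apply: leq_ltn_trans q_gt.
have chiE : is_first_constituent A a B b (charpoly R A a B b).
  move=> q q_gt0 q1; apply: horner_charpoly => //.
  by rewrite /coprime -gcdn_modl q1 gcdn_modl gcd1n.
split=> // f fE.
apply: (@poly_eq_on_nat _ _ _ (fun k => (k * rhoC A a B b).+1)) => [j k [] | k].
  by move/eqP; rewrite eqn_pmul2r ?rhoC_gt0 // => /eqP.
have q1 : (k * rhoC A a B b).+1 = 1 %[mod rhoC A a B b] by rewrite -addn1 modnMDl.
by rewrite natz chiE ?fE.
Qed.
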